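(* Let $a,b\in\mathbb{R}$ and let $L=aI+bE\in LC_2$ be regarded as an operator on $\mathbb{P}_2$. Then $$\sigma(L)=\{a-b,\;a+b\},\qquad \operatorname{Tr}(L)=2a,\qquad \det(L)=a^2-b^2.$$
   Context: $\mathbb{P}_2$ is the real vector space of all functions $f:\mathbb{R}\to\mathbb{R}$ with $f(t+2)=f(t)$ for all $t$. $I$ is the identity operator and $E$ the unit shift $(Ef)(t)=f(t+1)$ on $\mathbb{P}_2$, so $E^2=I$. $LC_2=\{xI+yE: x,y\in\mathbb{R}\}$. The spectrum $\sigma(L)$ is the set of all eigenvalues of $L$, i.e. of all $\lambda$ for which there is a nonzero $f\in\mathbb{P}_2$ with $Lf=\lambda f$. The trace $\operatorname{Tr}(L)$ is the sum, and the determinant $\det(L)$ the product, of the eigenvalues of $L$, with the convention that repeated eigenvalues are taken into account: the eigenvalues are listed as $a+b$ and $a-b$, so if $b=0$ the single eigenvalue $a$ is counted twice. *)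

(* Defs.v *)
From HB Require Import structures.
From mathcomp Require Import all_boot all_order all_algebra.
From mathcomp Require Import all_classical reals.

Set Implicit Arguments.
Unset Strict Implicit.
Unset Printing Implicit Defensive.

Import Order.TTheory GRing.Theory Num.Theory.
Local Open Scope classical_set_scope.
Local Open Scope ring_scope.

Definition periodic2 {R : realType} : {pred R -> R^o} :=
  [pred f | `[< forall t, f (t + 2) = f t >]].

Lemma periodic2P {R : realType} (f : R -> R^o) :
  reflect (forall t, f (t + 2) = f t) (f \in periodic2).
Proof. by rewrite inE; exact: asboolP. Qed.

Lemma periodic2_submod_closed (R : realType) : submod_closed (@periodic2 R).
Proof.
split; first by apply/periodic2P.
move=> k f g /periodic2P hf /periodic2P hg; apply/periodic2P => t.
by rewrite !fctE hf hg.
Qed.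

HB.instance Definition _ (R : realType) :=
  GRing.isSubmodClosed.Build R (R -> R^o) (@periodic2 R)
    (@periodic2_submod_closed R).

Record P2 (R : realType) :=
  MkP2 { P2fun :> R -> R^o; _ : P2fun \in periodic2 }.
Arguments P2fun {R} _ _.

HB.instance Definition _ (R : realType) := [isSub for @P2fun R].
HB.instance Definition _ (R : realType) := [Choice of P2 R by <:].
HB.instance Definition _ (R : realType) := [SubChoice_isSubLmodule of P2 R by <:].

Lemma shift_periodic2 (R : realType) (f : P2 R) :
  (fun t => f (t + 1)) \in @periodic2 R.
Proof.
apply/periodic2P => t; rewrite addrAC.
by case: f => f /= /periodic2P ->.
Qed.

Definition shift {R : realType} (f : P2 R) : P2 R := MkP2 (shift_periodic2 f).

Lemma shift_is_linear (R : realType) : linear (@shift R).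
Proof. by move=> k f g; apply/val_inj/funext => t. Qed.

HB.instance Definition _ (R : realType) :=
  GRing.isLinear.Build R (P2 R) (P2 R) _ (@shift R) (@shift_is_linear R).

(* x I + y E; the operators of this form make up LC_2. *)
Definition lc2 {R : realType} (x y : R) : {linear P2 R -> P2 R} :=
  (x \*: (idfun : P2 R -> P2 R)) \+ (y \*: shift).

Definition spectrum {R : realType} (L : {linear P2 R -> P2 R}) : set R :=
  [set l | exists f : P2 R, f != 0 /\ L f = l *: f].

(* The coefficients (x, y) of an operator x I + y E; they are unique, since I
   and E are linearly independent.  Junk value (0, 0) outside LC_2. *)
Definition coefs {R : realType} (L : {linear P2 R -> P2 R}) : R * R :=
  xget (0, 0) [set c : R * R | L =1 lc2 c.1 c.2].

(* P2 is infinite-dimensional, so neither dimension of eigenspaces nor a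
   characteristic polynomial is available to count repetitions: the
   multiplicity of an eigenvalue of L = x I + y E is the number of times it
   occurs in the list x + y, x - y (hence 2 for x when y = 0). *)
Definition multiplicity {R : realType} (L : {linear P2 R -> P2 R}) (l : R)
  : nat :=
  let: (x, y) := coefs L in count_mem l [:: x + y; x - y].

(* Sum and product of the eigenvalues of L in LC_2, with multiplicity. *)
Definition op_trace {R : realType} (L : {linear P2 R -> P2 R}) : R :=
  \sum_(l \in spectrum L) l *+ multiplicity L l.

Definition op_det {R : realType} (L : {linear P2 R -> P2 R}) : R :=
  \big[*%R/1]_(l \in spectrum L) l ^+ multiplicity L l.

(* Main.v *)
Require Import Defs.
From HB Require Import structures.
From mathcomp Require Import all_boot all_order all_algebra.
From mathcomp Require Import all_classical reals.
From mathcomp Require Import ring lra.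
Import Order.TTheory GRing.Theory Num.Theory.
Local Open Scope classical_set_scope.
Local Open Scope ring_scope.

(** Since [E ^ 2 = I], every [f] in P_2 is half the sum of [f + E f], fixed by
    [E], and [f - E f], negated by [E].  On these two summands [L = a I + b E]
    is multiplication by [a + b] and by [a - b], so [L] has no other eigenvalue.
    Both values are attained: the constant [1] is fixed by [E], and the square
    wave [(-1) ^ floor t] is negated by it.

    Evaluating an operator [x I + y E] at these two eigenfunctions recovers
    [x + y] and [x - y], hence [x] and [y] ([coefs_lc2]).  The eigenvalues
    counted with multiplicity are therefore the list [a + b, a - b], and
    iterating an operation over its distinct values, each repeated as often as
    it occurs, is iterating over the list itself ([fsbig_iterop_count]); this
    covers the case [b = 0] as well. *)

Lemma P2_eqP (R : realType) (f g : P2 R) : (forall t, f t = g t) -> f = g.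
Proof. by move=> fg; apply/val_inj/funext. Qed.

Lemma lc2E (R : realType) (x y : R) (f : P2 R) (t : R) :
  lc2 x y f t = x * f t + y * f (t + 1).
Proof. by []. Qed.

Lemma P2_periodic (R : realType) (f : P2 R) (t : R) : f (t + 1 + 1) = f t.
Proof. by rewrite -addrA; case: f => f /= /periodic2P; apply. Qed.

Lemma const1_periodic2 (R : realType) : (fun=> 1) \in @periodic2 R.
Proof. by apply/periodic2P. Qed.

Definition const1 (R : realType) : P2 R := MkP2 (const1_periodic2 R).

Lemma signr_floorD1 (R : realType) (t : R) :
  (-1) ^ Num.floor (t + 1) = - (-1) ^ Num.floor t :> R.
Proof.
by rewrite floorDrz ?rpred1// floor1 expfzDr ?oppr_eq0 ?oner_eq0// expr1z mulrN1.
Qed.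

Lemma square_wave_periodic2 (R : realType) :
  (fun t => (-1) ^ Num.floor t) \in @periodic2 R.
Proof.
by apply/periodic2P => t; rewrite -[2]/(1 + 1) addrA !signr_floorD1 opprK.
Qed.

Definition square_wave (R : realType) : P2 R :=
  MkP2 (square_wave_periodic2 R).

Lemma const1_eigen (R : realType) (x y : R) :
  lc2 x y (const1 R) = (x + y) *: const1 R.
Proof. by apply: P2_eqP => t; rewrite lc2E -mulrDl. Qed.

Lemma square_wave_eigen (R : realType) (x y : R) :
  lc2 x y (square_wave R) = (x - y) *: square_wave R.
Proof.
by apply: P2_eqP => t; rewrite lc2E /= signr_floorD1 mulrN -mulNr -mulrDl.
Qed.

Lemma const1_neq0 (R : realType) : const1 R != 0.
Proof.
by apply/eqP => /(congr1 (fun f : P2 R => f 0)) /eqP; rewrite /= oner_eq0.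
Qed.

Lemma square_wave_neq0 (R : realType) : square_wave R != 0.
Proof.
apply/eqP => /(congr1 (fun f : P2 R => f 0)) /eqP.
by rewrite /= floor0 expr0z oner_eq0.
Qed.

(** Adding and subtracting the eigenvalue equation at [t] and at [t + 1] gives
    [(l - (a + b)) (f + E f) = 0] and [(l - (a - b)) (f - E f) = 0]; if neither
    scalar vanishes then [f + E f = f - E f = 0], which forces [f = 0].
    Conversely, the two eigenfunctions above attain both values. *)
Lemma spectrum_lc2 (R : realType) (a b : R) :
  spectrum (lc2 a b) = [set a - b; a + b].
Proof.
apply/seteqP; split=> [l [f [f_neq0 Lf]]|l [->|->]]; last 2 first.
- by exists (square_wave R); rewrite square_wave_neq0 square_wave_eigen.
- by exists (const1 R); rewrite const1_neq0 const1_eigen.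
have ev t : a * f t + b * f (t + 1) = l * f t.
  by rewrite -lc2E Lf.
have evS t : a * f (t + 1) + b * f t = l * f (t + 1).
  by have := ev (t + 1); rewrite P2_periodic.
have evD t : (l - (a + b)) * (f t + f (t + 1)) = 0.
  by have := ev t; have := evS t; lra.
have evB t : (l - (a - b)) * (f t - f (t + 1)) = 0.
  by have := ev t; have := evS t; lra.
have [->|lB] := eqVneq l (a - b); first by left.
have [->|lD] := eqVneq l (a + b); first by right.
case/eqP: f_neq0; apply: P2_eqP => t.
move/eqP: (evD t); rewrite mulf_eq0 subr_eq0 (negPf lD) /= => /eqP fD.
move/eqP: (evB t); rewrite mulf_eq0 subr_eq0 (negPf lB) /= => /eqP fB.
by have -> : f t = 0 by lra.
Qed.

Lemma scaler_injl (F : fieldType) (V : lmodType F) (v : V) (k l : F) :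
  v != 0 -> k *: v = l *: v -> k = l.
Proof.
move=> v_neq0 /eqP.
by rewrite -subr_eq0 -scalerBl scaler_eq0 subr_eq0 (negPf v_neq0) orbF => /eqP.
Qed.

Lemma coefs_lc2 (R : realType) (a b : R) : coefs (lc2 a b) = (a, b).
Proof.
rewrite /coefs; case: xgetP => [[x y] _|/(_ (a, b))[]//].
change (lc2 a b =1 lc2 x y -> (x, y) = (a, b)) => Lxy.
have D : a + b = x + y.
  apply: (@scaler_injl _ _ _ _ _ (const1_neq0 R)).
  by rewrite -!const1_eigen Lxy.
have B : a - b = x - y.
  apply: (@scaler_injl _ _ _ _ _ (square_wave_neq0 R)).
  by rewrite -!square_wave_eigen Lxy.
by have [-> ->] : x = a /\ y = b by split; lra.
Qed.

Lemma multiplicity_lc2 (R : realType) (a b l : R) :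
  multiplicity (lc2 a b) l = count_mem l [:: a + b; a - b].
Proof. by rewrite /multiplicity coefs_lc2. Qed.

(** Since [l *+ n] and [l ^+ n] both unfold to an [iterop], this form serves the
    trace and the determinant alike.  It holds because [undup s] lists the
    values of [s] without repetition. *)
Lemma fsbig_iterop_count (T : Type) (idx : T) (op : Monoid.com_law idx)
    (I : choiceType) (s : seq I) (F : I -> T) :
  \big[op/idx]_(i \in [set` s]) iterop (count_mem i s) op (F i) idx =
  \big[op/idx]_(i <- s) F i.
Proof.
have -> : [set` s] = [set` undup s].
  by apply/seteqP; split=> i /=; rewrite mem_undup.
by rewrite -fsbig_seq ?undup_uniq// big_undup_iterop_count.
Qed.

Theorem theorem2p35 (R : realType) (a b : R) :
  let L := lc2 a b in
  [/\ spectrum L = [set a - b; a + b],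
      op_trace L = 2 * a
    & op_det L = a ^+ 2 - b ^+ 2].
Proof.
move=> L; have specE : spectrum L = [set` [:: a + b; a - b]].
  rewrite spectrum_lc2; apply/seteqP; split=> l /=; rewrite !inE.
    by case=> ->; rewrite eqxx ?orbT.
  by case/orP=> /eqP ->; [right|left].
split; first exact: spectrum_lc2.
- rewrite /op_trace specE.
  under eq_fsbigr do rewrite multiplicity_lc2.
  rewrite (@fsbig_iterop_count _ _ _ _ _ id) !big_cons big_nil /=; ring.
- rewrite /op_det specE.
  under eq_fsbigr do rewrite multiplicity_lc2.
  rewrite (@fsbig_iterop_count _ _ _ _ _ id) !big_cons big_nil /=; ring.
Qed.
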